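(* Let $(K,v)$ be a valued field with value group $G$ and residue field $Kv$. Let $\mathcal{O}$ be the set of field orders of $Kv$ and $\mathcal{E}$ the set of group homomorphisms from $G$ to $\{-1,1\}$. Then $\mathcal{O}\times\mathcal{E}$ is in bijection with the set of families $(\leq_g)_{g\in G}$, where each $\leq_g$ is a group order on $K^g/K_g$, whose lifting to $K$ is a field order.
   Context: All orders are total. The value group $G$ is written additively (with $v:K\to G\cup\{\infty\}$ surjective). For $g\in G$, $K^g=\{a\in K\mid v(a)\geq g\}$ and $K_g=\{a\in K\mid v(a)>g\}$, both viewed as subgroups of $(K,+)$; $Kv=K^0/K_0$ is the residue field. The lifting of a family $(\leq_g)_{g\in G}$ of group orders on the quotients $K^g/K_g$ to $K$ is the unique group order $\leq$ on $(K,+)$ with which $v$ is compatible (i.e. $0\leq a\leq b$ implies $v(a)\geq v(b)$) and which induces $\leq_g$ on $K^g/K_g$ for every $g\in G$; equivalently, for $a\neq 0$ with $g=v(a)$, one has $0\leq a$ if and only if $0\leq_g a+K_g$. Here the order induced by $\leq$ on $K^g/K_g$ is $a+K_g\leq_g b+K_g\Leftrightarrow\exists c,d\in K_g,\ a+c\leq b+d$. *)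

(* Defs.v *)
From HB Require Import structures.
From mathcomp Require Import all_boot all_order all_algebra.
From mathcomp Require Import generic_quotient ring_quotient.
From mathcomp Require Import boolp classical_sets functions.

Set Implicit Arguments.
Unset Strict Implicit.
Unset Printing Implicit Defensive.

Import Order.TTheory GRing.Theory Num.Theory.
Local Open Scope ring_scope.
Local Open Scope quotient_scope.

Definition total_order (T : Type) (R : rel T) : Prop :=
  [/\ reflexive R, antisymmetric R, transitive R & total R].

Definition group_order (V : zmodType) (R : rel V) : Prop :=
  total_order R /\ forall x y z : V, R x y -> R (x + z) (y + z).

Definition field_order (F : fieldType) (R : rel F) : Prop :=
  group_order R /\ forall x y : F, R 0 x -> R 0 y -> R 0 (x * y).

Record ordered_group := OrderedGroup {
  og_carrier :> zmodType;
  og_le : rel og_carrier;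
  og_group_order : group_order og_le
}.

(* G u {oo} is [option G], with [None] playing the role of oo. *)

Definition ole (G : ordered_group) (x y : option G) : bool :=
  match x, y with
  | _, None => true
  | None, Some _ => false
  | Some g, Some h => og_le g h
  end.

Definition olt (G : ordered_group) (x y : option G) : bool := ~~ ole y x.

Definition omin (G : ordered_group) (x y : option G) : option G :=
  if ole x y then x else y.

Definition oadd (G : ordered_group) (x y : option G) : option G :=
  match x, y with
  | Some g, Some h => Some (g + h)
  | _, _ => None
  end.

Record valuation (K : fieldType) (G : ordered_group) := Valuation {
  val_fun :> K -> option G;
  valuation_eq0 : forall a : K, val_fun a = None <-> a = 0;
  valuationM : forall a b : K, val_fun (a * b) = oadd (val_fun a) (val_fun b);
  valuationD : forall a b : K,
    ole (omin (val_fun a) (val_fun b)) (val_fun (a + b));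
  valuation_surj : forall x : option G, exists a : K, val_fun a = x
}.

Section OptionOrder.
Variable G : ordered_group.
Implicit Types (x y z : option G) (g h k : G).

Lemma og_lexx g : og_le g g.
Proof. by case: (og_group_order G) => -[]. Qed.

Lemma og_le_anti g h : og_le g h -> og_le h g -> g = h.
Proof. by case: (og_group_order G) => -[_ anti _ _] _ gh hg; apply: anti; rewrite gh. Qed.

Lemma og_le_trans : transitive (@og_le G).
Proof. by case: (og_group_order G) => -[]. Qed.

Lemma og_le_total : total (@og_le G).
Proof. by case: (og_group_order G) => -[]. Qed.

Lemma og_leD2r k g h : og_le g h -> og_le (g + k) (h + k).
Proof. by case: (og_group_order G) => _; apply. Qed.

Lemma og_double_eq0 g : g + g = 0 -> g = 0.
Proof.
move=> gg; case/orP: (og_le_total g 0) => g0; have := og_leD2r g g0;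
  by rewrite gg add0r => g0'; apply: og_le_anti.
Qed.

Lemma ole_trans : transitive (@ole G).
Proof. by move=> [?|] [?|] [?|] //=; exact: og_le_trans. Qed.

Lemma ole_total : total (@ole G).
Proof. by move=> [?|] [?|] //=; exact: og_le_total. Qed.

Lemma ole_omin x y z : ole x (omin y z) = ole x y && ole x z.
Proof.
rewrite /omin; case: ifPn => yz.
  by case xy: (ole x y) => //=; rewrite (ole_trans xy yz).
have zy : ole z y by case/orP: (ole_total y z) => // h; rewrite h in yz.
by case xz: (ole x z); rewrite ?andbT ?andbF // (ole_trans xz zy).
Qed.

Lemma olt_omin x y z : olt x (omin y z) = olt x y && olt x z.
Proof.
rewrite /olt /omin; case: ifPn => yz.
  case yx: (ole y x) => //=; apply/esym/negP => zx.
  by rewrite (ole_trans yz zx) in yx.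
have zy : ole z y by case/orP: (ole_total y z) => // h; rewrite h in yz.
case zx: (ole z x); rewrite ?andbT ?andbF //; apply/esym/negP => yx.
by rewrite (ole_trans zy yx) in zx.
Qed.

Lemma olt_le_trans x y z : olt x y -> ole y z -> olt x z.
Proof. by rewrite /olt => /negP xy yz; apply/negP => /(ole_trans yz). Qed.

End OptionOrder.

Section ValuationTheory.
Variables (K : fieldType) (G : ordered_group) (v : valuation K G).

Lemma val0 : v 0 = None. Proof. by apply/valuation_eq0. Qed.

Lemma val1 : v 1 = Some 0.
Proof.
have := valuationM v 1 1; rewrite mulr1; case v1: (v 1) => [g|] /=.
  by case=> /(congr1 (fun h => h - g)); rewrite subrr addrK => <-.
by move/valuation_eq0: v1 => /eqP; rewrite oner_eq0.
Qed.

Lemma valN a : v (- a) = v a.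
Proof.
rewrite -mulN1r valuationM.
have := valuationM v (-1) (-1); rewrite mulrNN mulr1 val1.
case: (v (-1)) => //= g [/esym /og_double_eq0 ->].
by case: (v a) => //= h; rewrite add0r.
Qed.

Lemma valV a g : v a = Some g -> v a^-1 = Some (- g).
Proof.
move=> va; have a0 : a != 0 by apply/eqP => /(valuation_eq0 v); rewrite va.
have := valuationM v a a^-1; rewrite divff // val1 va.
case: (v a^-1) => //= h [] /(congr1 (fun k => - g + k)).
by rewrite addr0 addKr => ->.
Qed.

End ValuationTheory.

Section Quotients.
Variables (K : fieldType) (G : ordered_group) (v : valuation K G).

Definition val_ge (g : G) : {pred K} := fun a => ole (Some g) (v a).
Definition val_gt (g : G) : {pred K} := fun a => olt (Some g) (v a).

Lemma val_ge_zmod_closed g : zmod_closed (val_ge g).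
Proof.
split=> [|a b ha hb]; rewrite unfold_in /val_ge; first by rewrite val0.
by apply: ole_trans (valuationD v a (- b)); rewrite ole_omin valN; apply/andP.
Qed.

Lemma val_gt_zmod_closed g : zmod_closed (val_gt g).
Proof.
split=> [|a b ha hb]; rewrite unfold_in /val_gt; first by rewrite val0.
by apply: olt_le_trans (valuationD v a (- b)); rewrite olt_omin valN; apply/andP.
Qed.

HB.instance Definition _ g :=
  GRing.isZmodClosed.Build K (val_ge g) (val_ge_zmod_closed g).
HB.instance Definition _ g :=
  GRing.isZmodClosed.Build K (val_gt g) (val_gt_zmod_closed g).

(* K^g as a type, K_g as a subgroup of K^g, and K^g / K_g. *)
Definition upper (g : G) : Type := {a : K | a \in val_ge g}.

HB.instance Definition _ g := SubChoice.on (upper g).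
HB.instance Definition _ g := [SubChoice_isSubZmodule of upper g by <:].

Definition lower (g : G) : {pred upper g} := fun a => \val a \in val_gt g.

Lemma lower_zmod_closed g : zmod_closed (@lower g).
Proof.
have [lt0 ltB] := val_gt_zmod_closed g.
by split=> [|a b]; [exact: lt0 | exact: ltB].
Qed.

HB.instance Definition _ g :=
  GRing.isZmodClosed.Build (upper g) (@lower g) (@lower_zmod_closed g).

Definition layer (g : G) : zmodType := Quotient.quot (@lower g).

(* The residue field. The aliases below carry the ring structures that only
   exist for g = 0, and are built on top of the additive structures of
   [upper 0] and [lower 0], so that [residue] is [layer 0]. *)
Definition valring_pred : {pred K} := val_ge 0.

Lemma valring_subring_closed : subring_closed valring_pred.
Proof.
split; first by rewrite unfold_in /valring_pred /val_ge val1 /= og_lexx.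
  exact: (val_ge_zmod_closed 0).2.
move=> a b; rewrite !unfold_in /valring_pred /val_ge valuationM.
case: (v a) (v b) => [g|] [h|] //= g0 h0.
by apply: og_le_trans h0 _; rewrite -{1}[h]add0r og_leD2r.
Qed.

HB.instance Definition _ :=
  GRing.isSubringClosed.Build K valring_pred valring_subring_closed.

Definition valring : Type := {a : K | a \in valring_pred}.

HB.instance Definition _ := SubChoice.on valring.
HB.instance Definition _ := GRing.Zmodule.copy valring (upper 0).
HB.instance Definition _ :=
  GRing.isSubZmodule.Build K valring_pred valring (fun x y => erefl).
HB.instance Definition _ := [SubZmodule_isSubNzRing of valring by <:].
HB.instance Definition _ := [SubNzRing_isSubComNzRing of valring by <:].

Definition valideal : {pred valring} := fun a => \val a \in val_gt 0.

Lemma valideal_proper :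
  1 \notin valideal /\ forall a, {in valideal, forall u, a * u \in valideal}.
Proof.
split.
  by rewrite unfold_in /valideal unfold_in /val_gt /= val1 /olt /= og_lexx.
move=> a x xI.
have : ole (Some 0) (v (\val a)) := valP a.
have : olt (Some 0) (v (\val x)) := xI.
rewrite unfold_in /valideal unfold_in /val_gt /= valuationM /olt.
case: (v (\val a)) (v (\val x)) => [g|] [h|] //= + g0; apply: contra.
by apply: og_le_trans; rewrite -{1}[h]add0r og_leD2r.
Qed.

HB.instance Definition _ :=
  GRing.isZmodClosed.Build valring valideal (@lower_zmod_closed 0).
HB.instance Definition _ :=
  isProperIdeal.Build valring valideal valideal_proper.

Definition residue : Type := {ideal_quot valideal}.

HB.instance Definition _ := GRing.ComNzRing.on residue.

Lemma residue_layer0 : (residue : zmodType) = layer 0.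
Proof. by []. Qed.

Lemma valring_inverse (a : valring) :
  a \notin valideal -> exists b : valring, a * b = 1.
Proof.
case: a => a aP aI.
have : ole (Some 0) (v a) := aP.
have : ~~ olt (Some 0) (v a) := aI.
rewrite /olt negbK; case va: (v a) => [g|] //= g0 g0'.
have g_eq0 : g = 0 by apply: og_le_anti.
have a_neq0 : a != 0 by apply/eqP => /(valuation_eq0 v); rewrite va.
have bP : a^-1 \in valring_pred.
  by rewrite unfold_in /valring_pred /val_ge (valV va) g_eq0 oppr0 /= og_lexx.
by exists (exist _ a^-1 bP); apply: val_inj; rewrite /= divff.
Qed.

Lemma residue_inverse (x : residue) : x != 0 -> exists y : residue, y * x = 1.
Proof.
rewrite -[x]reprK -[0 : residue]/(0 : {ideal_quot valideal}).
rewrite piE Quotient.equivE subr0 => /valring_inverse [b ab].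
by exists (\pi_{ideal_quot valideal} b); rewrite mulrC -rmorphM ab rmorph1.
Qed.

Definition residue_inv (x : residue) : residue :=
  if pselect (x != 0) is left x0 then sval (cid (residue_inverse x0)) else 0.

Lemma residue_mulVf (x : residue) : x != 0 -> residue_inv x * x = 1.
Proof.
by rewrite /residue_inv; case: pselect => // x0 _; case: (cid _).
Qed.

Lemma residue_invr0 : residue_inv 0 = 0.
Proof. by rewrite /residue_inv; case: pselect => // x0; case/eqP: (x0). Qed.

HB.instance Definition _ :=
  GRing.ComNzRing_isField.Build residue residue_mulVf residue_invr0.

(* [R] on K induces the family [F]; since every class of K^g / K_g has a
   representative, this determines [F] from [R]. *)
Definition induces (R : rel K) (F : forall g : G, rel (layer g)) : Prop :=
  forall (g : G) (a b : upper g),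
    F g (\pi a) (\pi b) <->
    exists c d : K,
      [/\ c \in val_gt g, d \in val_gt g & R (\val a + c) (\val b + d)].

Definition compatible (R : rel K) : Prop :=
  forall a b : K, R 0 a -> R a b -> ole (v b) (v a).

Definition is_lifting (F : forall g : G, rel (layer g)) (R : rel K) : Prop :=
  [/\ group_order R, compatible R & induces R F].

Definition field_liftable : set (forall g : G, rel (layer g)) :=
  [set F | (forall g : G, group_order (F g)) /\
           exists R : rel K, is_lifting F R /\ field_order R].

End Quotients.

Arguments field_liftable {K G} v.

Definition field_orders (F : fieldType) : set (rel F) :=
  [set R : rel F | field_order R].

Arguments field_orders F : clear implicits.

Definition sign_homs (G : zmodType) : set (G -> int) :=
  [set e | (forall g, e g = 1 \/ e g = -1) /\
           (forall g h, e (g + h) = e g * e h)].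

Arguments sign_homs G : clear implicits.

(* Main.v *)
(* By the lifting correspondence, the liftable families are the compatible field
   orders on K. Such an order is given by its sign map, a homomorphism
   K^* -> {-1, 1}, and such a homomorphism comes from a compatible order
   inducing O on Kv exactly when its value at each unit u is the O-sign of the
   residue of u: additivity of the positive cone is then automatic, since
   a + b = a (1 + b / a) and, for v a <= v b and b / a nonnegative, 1 + b / a is
   a unit with positive residue. Hence the orders inducing a given O form a
   torsor under the homomorphisms K^* / units = G -> {-1, 1}. By Zorn's lemma
   the torsor is nonempty; a choice of one base point for each O gives the
   bijection. *)

Require Import Defs.
From mathcomp Require Import all_boot all_order all_algebra.
From mathcomp Require Import generic_quotient ring_quotient.
From mathcomp Require Import boolp classical_sets functions.

Set Implicit Arguments.
Unset Strict Implicit.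
Unset Printing Implicit Defensive.

Import GRing.Theory.
Local Open Scope ring_scope.
Local Open Scope classical_set_scope.
Local Open Scope quotient_scope.

(** * Group orders and field orders, through the signs of differences *)

Section GroupOrder.
Variables (V : zmodType) (R : rel V).
Hypothesis R_order : group_order R.

Lemma group_order_subr x y : R x y = R 0 (y - x).
Proof.
case: R_order => _ RD; apply/idP/idP => [/(RD _ _ (- x))|/(RD _ _ x)].
  by rewrite subrr.
by rewrite add0r subrK.
Qed.

Lemma group_order_refl x : R x x.
Proof. by case: R_order => -[]. Qed.

Lemma group_order_trans y x z : R x y -> R y z -> R x z.
Proof. by case: R_order => -[_ _ tr _] _; apply: tr. Qed.

Lemma group_order_anti x y : R x y -> R y x -> x = y.
Proof. by case: R_order => -[_ anti _ _] _ xy yx; apply: anti; rewrite xy. Qed.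

Lemma group_order_total x y : R x y || R y x.
Proof. by case: R_order => -[]. Qed.

Lemma group_order_addl z x y : R x y -> R (z + x) (z + y).
Proof. by case: R_order => _ RD /(RD _ _ z); rewrite ![z + _]addrC. Qed.

Lemma group_order_addr_ge0 x y : R 0 x -> R 0 y -> R 0 (x + y).
Proof.
move=> x0 y0; apply: group_order_trans x0 _.
by rewrite group_order_subr addrC addKr.
Qed.

Lemma group_order_oppr_ge0 x : x != 0 -> R 0 (- x) = ~~ R 0 x.
Proof.
move=> x0; have := group_order_total 0 x.
rewrite [R x 0]group_order_subr sub0r; case x_ge0: (R 0 x) => //= _.
apply/negP; rewrite -sub0r -group_order_subr => x_le0.
by case/eqP: x0; apply: group_order_anti.
Qed.

End GroupOrder.

Section FieldOrder.
Variables (F : fieldType) (R : rel F).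
Hypothesis R_order : field_order R.

Lemma field_order_ge01 : R 0 1.
Proof.
have [R_group RM] := R_order; have := group_order_oppr_ge0 R_group (oner_neq0 F).
case R01: (R 0 1) => //= N1_ge0.
by have := RM _ _ N1_ge0 N1_ge0; rewrite mulrNN mulr1 R01.
Qed.

Lemma field_order_mul_ge0 x y :
  x != 0 -> y != 0 -> R 0 (x * y) = (R 0 x == R 0 y).
Proof.
move=> x0 y0; have [R_group RM] := R_order.
have xy0 : x * y != 0 by rewrite mulf_neq0.
have Nx := group_order_oppr_ge0 R_group x0.
have Ny := group_order_oppr_ge0 R_group y0.
have Nxy := group_order_oppr_ge0 R_group xy0.
case xP: (R 0 x) Nx => Nx; case yP: (R 0 y) Ny => Ny.
- by rewrite RM.
- by apply/negbTE; rewrite -Nxy -mulrN RM.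
- by apply/negbTE; rewrite -Nxy -mulNr RM.
- by rewrite -mulrNN RM.
Qed.

End FieldOrder.

(** * Values of quotients and the residue map *)

Section Valued.
Variables (K : fieldType) (G : ordered_group) (v : valuation K G).

Lemma val_neq0 (a : K) : a != 0 -> exists g, v a = Some g.
Proof.
by move/eqP; case va: (v a) => [g|] a0; [exists g | case: a0; apply/(valuation_eq0 v)].
Qed.

Lemma neq0_val {a : K} {g} : v a = Some g -> a != 0.
Proof. by move=> va; apply/eqP => /(valuation_eq0 v); rewrite va. Qed.

Lemma ole_val_div {a b : K} : a != 0 ->
  ole (Some 0) (v (b / a)) = ole (v a) (v b).
Proof.
move=> /val_neq0 [g va]; rewrite valuationM (valV va) va.
case: (v b) => //= h; apply/idP/idP => [/(og_leD2r g)|/(og_leD2r (- g))].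
  by rewrite add0r subrK.
by rewrite subrr.
Qed.

Lemma olt_val_div {a b : K} : a != 0 ->
  olt (Some 0) (v (b / a)) = olt (v a) (v b).
Proof.
move=> /val_neq0 [g va]; rewrite /olt valuationM (valV va) va.
case: (v b) => //= h; congr (~~ _).
apply/idP/idP => [/(og_leD2r g)|/(og_leD2r (- g))].
  by rewrite add0r subrK.
by rewrite subrr.
Qed.

(* Outside the valuation ring the value is the junk residue 0. *)
Definition residue_of (a : K) : residue v :=
  \pi_(residue v) (insubd (0 : valring v) a).

Lemma residue_of_val (a : valring v) : residue_of (\val a) = \pi_(residue v) a.
Proof. by rewrite /residue_of valKd. Qed.

Lemma residue_ofD a b : ole (Some 0) (v a) -> ole (Some 0) (v b) ->
  residue_of (a + b) = residue_of a + residue_of b.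
Proof.
move=> va vb; set x : valring v := exist _ a va; set y : valring v := exist _ b vb.
rewrite -[a]/(\val x) -[b]/(\val y) -[_ + _]/(\val (x + y)) !residue_of_val.
exact: rmorphD.
Qed.

Lemma residue_ofM a b : ole (Some 0) (v a) -> ole (Some 0) (v b) ->
  residue_of (a * b) = residue_of a * residue_of b.
Proof.
move=> va vb; set x : valring v := exist _ a va; set y : valring v := exist _ b vb.
rewrite -[a]/(\val x) -[b]/(\val y) -[_ * _]/(\val (x * y)) !residue_of_val.
exact: rmorphM.
Qed.

Lemma residue_of1 : residue_of 1 = 1.
Proof. by rewrite -[1 in LHS]/(\val (1 : valring v)) residue_of_val rmorph1. Qed.

Lemma residue_ofN a : ole (Some 0) (v a) -> residue_of (- a) = - residue_of a.
Proof.
move=> va; set x : valring v := exist _ a va.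
rewrite -[a]/(\val x) -[- _ in LHS]/(\val (- x)) !residue_of_val.
exact: rmorphN.
Qed.

Lemma residue_of_eq0 a : ole (Some 0) (v a) ->
  (residue_of a == 0) = olt (Some 0) (v a).
Proof.
move=> va; set x : valring v := exist _ a va.
rewrite -[a]/(\val x) !residue_of_val -[0 : residue v]/(0 : {ideal_quot _}).
by rewrite piE Quotient.equivE subr0.
Qed.

Lemma residue_of_surj x : exists2 a, ole (Some 0) (v a) & residue_of a = x.
Proof.
exists (\val (repr x)); first exact: (valP (repr x)).
by rewrite residue_of_val reprK.
Qed.

Lemma val_unit_ge a : v a = Some 0 -> ole (Some 0) (v a).
Proof. by move=> ->; apply: og_lexx. Qed.

Lemma residue_of_unit a : ole (Some 0) (v a) ->
  (residue_of a != 0) <-> v a = Some 0.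
Proof.
move=> va; rewrite residue_of_eq0 // /olt negbK.
case: (v a) va => //= g g0; split=> [g0'|[->]]; last exact: og_lexx.
by congr Some; apply: og_le_anti.
Qed.


(* [P] is the set of nonnegative elements; the equation for products says that
   the sign is multiplicative on K^*. *)
Definition positive_cone (O : rel (residue v)) (P : pred K) : Prop :=
  [/\ P 0,
      forall a b, a != 0 -> b != 0 -> P (a * b) = (P a == P b) &
      forall u, v u = Some 0 -> P u = O 0 (residue_of u)].

Definition cone_order (P : pred K) : rel K := fun a b => P (b - a).

(** * From a positive cone to a compatible field order *)

Section PositiveCone.
Variables (O : rel (residue v)) (P : pred K).
Hypotheses (O_order : field_order O) (P_cone : positive_cone O P).

(** The residue of 1 + a is 1 plus a nonnegative element, and it is nonzero because -1 is negative
    in [O]; so 1 + a is a unit whose sign is read in the residue field. Additivity of the cone and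
    compatibility with [v] both reduce to this. *)
Lemma residue_of_ge0_succ a : ole (Some 0) (v a) -> O 0 (residue_of a) ->
  v (1 + a) = Some 0 /\ P (1 + a).
Proof.
have [[O_group _] [_ _ Punit]] := (O_order, P_cone).
have v1 := val_unit_ge (Defs.val1 v).
move=> va a0; have res1a : residue_of (1 + a) = 1 + residue_of a.
  by rewrite residue_ofD // residue_of1.
have ge1a : O 0 (residue_of (1 + a)).
  by rewrite res1a; apply: group_order_addr_ge0 => //; exact: field_order_ge01.
suff v1a : v (1 + a) = Some 0 by rewrite Punit.
have v1a : ole (Some 0) (v (1 + a)).
  by apply: ole_trans (valuationD v 1 a); rewrite ole_omin v1.
apply/(residue_of_unit v1a)/negP; rewrite res1a addr_eq0 => /eqP res1.
have := field_order_ge01 O_order; rewrite res1 group_order_oppr_ge0 ?a0 //.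
by apply/eqP => ra0; move: res1; rewrite ra0 oppr0 => /eqP; rewrite oner_eq0.
Qed.

(** -1 is a unit, and its residue is negative in [O]. *)
Lemma positive_coneN a : a != 0 -> P (- a) = ~~ P a.
Proof.
move=> a0; have [[O_group _] [_ PM Punit]] := (O_order, P_cone).
rewrite -mulN1r PM ?oppr_eq0 ?oner_neq0 // Punit ?valN ?Defs.val1 //.
rewrite residue_ofN ?val_unit_ge ?Defs.val1 // residue_of1.
by rewrite group_order_oppr_ge0 ?oner_neq0 // field_order_ge01.
Qed.

Lemma positive_coneD a b : P a -> P b -> P (a + b).
Proof.
have [_ PM Punit] := P_cone.
wlog vab : a b / ole (v a) (v b).
  move=> wlog_ab aP bP; case/orP: (ole_total (v a) (v b)) => ?; first exact: wlog_ab.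
  by rewrite addrC; apply: wlog_ab.
have [->|a0] := eqVneq a 0; first by rewrite add0r.
have [->|b0] := eqVneq b 0; first by rewrite addr0.
move=> aP bP; have t0 : b / a != 0 by rewrite mulf_neq0 ?invr_neq0.
have vt : ole (Some 0) (v (b / a)) by rewrite ole_val_div.
have tP : P (b / a) by move: bP; rewrite -{1}(divfK a0 b) (PM (b / a)) // aP => /eqP.
have [v1t P1t] : v (1 + b / a) = Some 0 /\ P (1 + b / a).
  apply: residue_of_ge0_succ => //.
  (* A nonzero residue makes b / a a unit, whose sign in [P] is that of its residue; a zero residue
     is nonnegative by reflexivity. *)
  have [/(residue_of_unit vt)/Punit <- //|] := boolP (residue_of (b / a) != 0).
  by rewrite negbK => /eqP ->; apply: group_order_refl; case: O_order.
have -> : a + b = a * (1 + b / a) by rewrite mulrDr mulr1 mulrC divfK.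
by rewrite PM ?(neq0_val v1t) // aP P1t.
Qed.

Lemma cone_order_field : field_order (cone_order P).
Proof.
have [P0 PM _] := P_cone; rewrite /cone_order; split; first split; first split.
- by move=> a; rewrite subrr.
- move=> a b /andP[]; rewrite -opprB.
  have [/eqP|ba0 ] := eqVneq (a - b) 0; first by rewrite subr_eq0 => /eqP.
  by rewrite positive_coneN // => /negbTE ->.
- move=> b a c ab bc; rewrite -(subrKA b) addrC; exact: positive_coneD.
- move=> a b; rewrite -[a - b]opprB.
  have [->|ba0] := eqVneq (b - a) 0; first by rewrite P0.
  by rewrite positive_coneN // orbN.
- by move=> a b c; rewrite opprD addrACA subrr addr0.
- move=> a b; rewrite !subr0 => aP bP.
  have [->|a0] := eqVneq a 0; first by rewrite mul0r.
  have [->|b0] := eqVneq b 0; first by rewrite mulr0.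
  by rewrite PM // aP bP.
Qed.

(** If v a < v b, then b / a has residue 0, so 1 - b / a is a positive unit and b - a = - a (1 - b /
    a) has the sign opposite to that of a. *)
Lemma cone_order_compatible : compatible v (cone_order P).
Proof.
have [_ PM _] := P_cone; have [O_group _] := O_order.
move=> a b; rewrite /cone_order subr0 => aP baP; apply/negPn/negP => vab.
have a0 : a != 0 by apply/eqP => a0; move: vab; rewrite a0 val0; case: (v b).
have vt : olt (Some 0) (v (- (b / a))) by rewrite valN olt_val_div.
have vt' : ole (Some 0) (v (- (b / a))).
  by move: vt; rewrite /olt; case/orP: (ole_total (Some 0) (v (- (b / a)))) => ->.
have [v1t P1t] : v (1 - b / a) = Some 0 /\ P (1 - b / a).
  apply: residue_of_ge0_succ => //.
  by move: vt; rewrite -residue_of_eq0 // => /eqP ->; apply: group_order_refl.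
move: baP; have -> : b - a = a * - (1 - b / a).
  by rewrite opprB mulrBr mulr1 mulrC divfK.
by rewrite PM ?oppr_eq0 ?(neq0_val v1t) // aP positive_coneN ?(neq0_val v1t) // P1t.
Qed.

End PositiveCone.

(** * Existence of a positive cone over a given order, by Zorn's lemma *)

Section Extension.
Variable O : rel (residue v).
Hypothesis O_order : field_order O.

(** The multiplicative group generated by the nonzero squares and the units with positive residue.
    Every positive cone over [O] must contain it. *)
Let positive_square_class (x : K) : Prop :=
  exists c, v (x * c ^+ 2) = Some 0 /\ O 0 (residue_of (x * c ^+ 2)).

(** Sums are not mentioned: [positive_coneD] recovers additivity once a cone is found. Such a set is
    a group, since the inverse of x is x times the square of x^-1. *)
Let precone (A : set K) : Prop :=
  [/\ positive_square_class `<=` A,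
      forall x y, A x -> A y -> A (x * y), ~ A 0 & ~ A (-1)].

Lemma positive_square_class_unit u :
  v u = Some 0 -> O 0 (residue_of u) -> positive_square_class u.
Proof. by move=> vu u0; exists 1; rewrite expr1n mulr1. Qed.

Lemma positive_square_class_sqr c : c != 0 -> positive_square_class (c ^+ 2).
Proof.
move=> c0; exists c^-1; rewrite -exprMn divff // expr1n Defs.val1.
by rewrite residue_of1 field_order_ge01.
Qed.

Lemma positive_square_classM x y : positive_square_class x ->
  positive_square_class y -> positive_square_class (x * y).
Proof.
move=> [c [vx x0]] [d [vy y0]]; exists (c * d).
have -> : x * y * (c * d) ^+ 2 = (x * c ^+ 2) * (y * d ^+ 2).
  by rewrite exprMn mulrACA.
rewrite valuationM vx vy /= addr0 residue_ofM ?val_unit_ge //.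
by split=> //; case: O_order => _; apply.
Qed.

(** -1 is excluded as follows: if -c^2 is a unit then v c = 0, because [G] has no 2-torsion, and the
    residue of -c^2 is minus a nonzero square, hence negative in [O]. *)
Lemma precone_positive_square_class : precone positive_square_class.
Proof.
have [O_group _] := O_order.
split=> [x //|||]; first exact: positive_square_classM.
  by case=> c; rewrite mul0r val0; case.
case=> c []; rewrite mulN1r valN => vc2.
have c0 : c != 0.
  by apply/eqP => c0; move: vc2; rewrite c0 expr0n val0.
have vc : v c = Some 0.
  have [g vg] := val_neq0 c0; move: vc2; rewrite vg expr2 valuationM vg /=.
  by case=> /og_double_eq0 ->.
have rc0 : residue_of c != 0 by apply/residue_of_unit; rewrite ?val_unit_ge.
rewrite residue_ofN ?val_unit_ge // group_order_oppr_ge0 //; last first.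
  by apply/residue_of_unit; rewrite ?val_unit_ge.
by rewrite expr2 residue_ofM ?val_unit_ge // field_order_mul_ge0 // eqxx.
Qed.

Lemma precone_maximal :
  exists2 A, precone A & forall B, A `<=` B -> precone B -> B `<=` A.
Proof.
have [F Fchain|A [[A0|A_precone] Amax]] :=
  @Zorn_bigcup K [set A | A = set0 \/ precone A].
- move=> F_total; have [[A FA A_precone]|no_precone] :=
    pselect (exists2 A, F A & precone A); last first.
    left; apply/seteqP; split=> // x [A FA Ax].
    case: (Fchain _ FA) => [A0|A_precone]; first by rewrite A0 in Ax.
    by case: no_precone; exists A.
  right; have [A_class _ _ _] := A_precone; split.
  + by move=> x /A_class Ax; exists A.
  + have F_mul B x y : F B -> B x -> B y -> B (x * y).
      by case/Fchain => [-> //|[_ + _ _]]; apply.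
    move=> x y [B FB Bx] [C FC Cy].
    by case: (F_total _ _ FB FC) => sub;
      [exists C => // | exists B => //]; apply: F_mul => //; apply: sub.
  + by case=> B /Fchain [-> //|[]].
  + by case=> B /Fchain [-> //|[]].
- exfalso; apply: (Amax positive_square_class); last first.
    by right; exact: precone_positive_square_class.
  rewrite A0; split=> // sub; have := sub _ (positive_square_class_sqr (oner_neq0 K)).
  by [].
- exists A => // B AB B_precone x Bx; apply: contrapT => Ax.
  by apply: (Amax B); [split=> // /(_ x Bx) | right].
Qed.

(* A maximal proper multiplicative subgroup containing the positive square
   classes has index 2, since adjoining x would otherwise add -1. *)
Lemma positive_cone_exists : exists P, positive_cone O P.
Proof.
have [O_group _] := O_order.
have [A [A_class AM A0 AN1] Amax] := precone_maximal.
have Asqr c : c != 0 -> A (c ^+ 2).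
  by move=> c0; apply/A_class/positive_square_class_sqr.
have A_cover x : x != 0 -> ~ A x -> A (- x).
  move=> x0 Ax; apply: contrapT => ANx; apply: Ax.
  have mulA y : A (y * x^-1) -> A (y * x).
    move=> yx; have -> : y * x = y * x^-1 * x ^+ 2.
      by rewrite expr2 mulrA divfK.
    by apply: AM => //; apply: Asqr.
  (* With neither x nor -x in [A], the union of [A] and x [A] is still a precone: -1 in x [A] would
     put -x in [A], as x and x^-1 differ by a square. Maximality then puts x in [A]. *)
  apply: (Amax [set y | A y \/ A (y * x^-1)]) => [y|| /=]; first by left.
    split=> [y /A_class| y z [Ay|Ay] [Az|Az] | [] |[]] //=; first by left.
    - by left; apply: AM.
    - by right; rewrite -mulrA; apply: AM.
    - by right; rewrite mulrAC; apply: AM.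
    - by left; rewrite -[z](divfK x0) mulrCA; apply: AM => //; apply: mulA.
    - by rewrite mul0r.
    - by move/mulA; rewrite mulN1r.
  by right; rewrite divff // -(expr1n _ 2); apply: Asqr; exact: oner_neq0.
have A_excl x : A x -> ~ A (- x).
  have [->|x0] := eqVneq x 0; first by move/A0.
  move=> Ax ANx; apply: AN1.
  have -> : -1 = x * - x * x^-1 ^+ 2.
    by rewrite mulrN mulNr -expr2 -exprMn divff // expr1n.
  by apply: (AM _ _ (AM _ _ Ax ANx)); apply: Asqr; rewrite invr_neq0.
have A_neg x : x != 0 -> ~ A x <-> A (- x).
  by move=> x0; split; [exact: A_cover | move=> ANx /A_excl].
exists (fun x => (x == 0) || `[<A x>]); split; first by rewrite eqxx.
  move=> a b a0 b0; rewrite mulf_eq0 (negbTE a0) (negbTE b0) /=.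
  case: (asboolP (A a)) => Aa; case: (asboolP (A b)) => Ab.
  - by apply/asboolP/AM.
  - by apply/asboolPn/A_neg; rewrite ?mulf_neq0 // -mulrN; apply/AM => //; apply/A_neg.
  - by apply/asboolPn/A_neg; rewrite ?mulf_neq0 // -mulNr; apply/AM => //; apply/A_neg.
  - by apply/asboolP; rewrite -mulrNN; apply/AM; apply/A_neg.
(* A unit with positive residue lies in [A] by construction; if the residue is negative, -u lies in
   [A], so u does not. *)
move=> u vu; rewrite (negbTE (neq0_val vu)) /=; apply/asboolP/idP => [Au|u0].
  apply/negPn/negP; rewrite -group_order_oppr_ge0 //; last first.
    by apply/residue_of_unit; rewrite ?val_unit_ge.
  rewrite -residue_ofN ?val_unit_ge // => Nu0; apply: (A_excl _ Au).
  by apply/A_class/positive_square_class_unit => //; rewrite valN.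
by apply/A_class/positive_square_class_unit.
Qed.

End Extension.

(** * Sign homomorphisms acting on positive cones *)

Section Twist.
Variable O : rel (residue v).
Implicit Types (P Q : pred K) (e : G -> int).

(** The sign map of [P] multiplied by [e] composed with [v]: on booleans read as signs, [==] is the
    product. The default [true] keeps 0 in the cone. *)
Definition twist P e : pred K :=
  fun a => if v a is Some g then P a == (e g == 1) else true.

Lemma sign_hom0 e : sign_homs G e -> e 0 = 1.
Proof.
move=> [e_sign eM]; case: (e_sign 0) => // e0.
by have := eM 0 0; rewrite addr0 e0.
Qed.

Lemma twist_cone P e :
  sign_homs G e -> positive_cone O P -> positive_cone O (twist P e).
Proof.
move=> eh [P0 PM Punit]; have [e_sign eM] := eh; split.
- by rewrite /twist val0.
- move=> a b a0 b0; have [g vg] := val_neq0 a0; have [h vh] := val_neq0 b0.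
  rewrite /twist valuationM vg vh /= PM // eM.
  case: (P a) (P b) => -[];
    by case: (e_sign g) => ->; case: (e_sign h) => ->.
- by move=> u vu; rewrite /twist vu sign_hom0 // eqxx eqb_id Punit.
Qed.

Lemma twist_inj P e1 e2 : sign_homs G e1 -> sign_homs G e2 ->
  twist P e1 = twist P e2 -> e1 = e2.
Proof.
move=> [e1_sign _] [e2_sign _] e12; apply: funext => g.
have [a va] := valuation_surj v (Some g).
have := congr1 (fun f : pred K => f a) e12; rewrite /twist va.
by case: (e1_sign g) => ->; case: (e2_sign g) => ->; case: (P a).
Qed.

(** The quotient of the two sign maps is trivial on units, so it factors through [v]; [e] is the
    factor, computed on a section [s] of [v]. *)
Lemma twist_surj P Q : positive_cone O P -> positive_cone O Q ->
  exists2 e, sign_homs G e & Q = twist P e.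
Proof.
move=> [P0 PM Punit] [Q0 QM Qunit].
have [s sv] := choice (fun g => valuation_surj v (Some g)).
pose e g : int := if Q (s g) == P (s g) then 1 else -1.
have s0 g : s g != 0 by apply: (neq0_val (sv g)).
(* Independence of the section: a / s g is a unit, where [P] and [Q] agree. *)
have eE a g : v a = Some g -> e g = if Q a == P a then 1 else -1.
  move=> va; have a0 := neq0_val va; rewrite /e.
  have ut : v (a / s g) = Some 0 by rewrite valuationM va (valV (sv g)) /= subrr.
  have t0 := neq0_val ut; have QP : Q (a / s g) = P (a / s g) by rewrite Qunit ?Punit.
  have [Qa Pa] := (QM _ _ t0 (s0 g), PM _ _ t0 (s0 g)).
  rewrite divfK // in Qa Pa; rewrite Qa Pa QP.
  by case: (P (a / s g)) (Q (s g)) (P (s g)) => -[] [].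
exists e; last first.
  apply: funext => a; rewrite /twist; case va: (v a) => [g|]; last first.
    by move/valuation_eq0: va => ->.
  by rewrite (eE _ _ va); case: (Q a) (P a) => -[].
split=> g; first by rewrite /e; case: ifP; [left | right].
move=> h; have sgh : v (s g * s h) = Some (g + h) by rewrite valuationM !sv.
rewrite (eE _ _ sgh) QM // PM // /e.
by case: (Q (s g)) (P (s g)) (Q (s h)) (P (s h)) => -[] [] [].
Qed.

End Twist.

(** * Families of orders on the layers and their liftings *)

Section Lifting.
Implicit Types (R : rel K) (F : forall g : G, rel (layer v g)).

Definition order_family R : forall g : G, rel (layer v g) := fun g x y =>
  `[< exists c d, [/\ c \in val_gt v g, d \in val_gt v g &
                      R (\val (repr x) + c) (\val (repr y) + d)] >].

Arguments order_family R g x y : clear implicits.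

Lemma layer_eq g (a b : upper v g) :
  \pi_(layer v g) a = \pi_(layer v g) b <-> \val a - \val b \in val_gt v g.
Proof.
by split=> [/eqP|ab]; [|apply/eqP]; rewrite piE Quotient.equivE.
Qed.

Lemma layerD g (a b : upper v g) :
  \pi_(layer v g) (a + b) = \pi_(layer v g) a + \pi_(layer v g) b.
Proof. exact: Quotient.pi_add. Qed.

Lemma layer_repr g (a : upper v g) :
  \val (repr (\pi_(layer v g) a)) - \val a \in val_gt v g.
Proof. by apply/layer_eq; rewrite reprK. Qed.

(** Changing representatives adds elements of K_g, which the existential [c] and [d] absorb; so the
    choice made by [repr] is immaterial. *)
Lemma order_family_induces R : induces R (order_family R).
Proof.
move=> g a b; rewrite /order_family.
have shift (t s r : K) : t + (s - t + r) = s + r.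
  by rewrite addrA addrCA subrr addr0.
have ra := layer_repr a; have rb := layer_repr b.
set x := \val (repr _) in ra *; set y := \val (repr _) in rb *.
split=> [/asboolP|] [c [d [cg dg cd]]].
  exists (x - \val a + c), (y - \val b + d).
  by split; [apply: rpredD | apply: rpredD | rewrite !shift].
apply/asboolP; exists (c - (x - \val a)), (d - (y - \val b)); split; [exact: rpredB | exact: rpredB |].
by rewrite !opprB [c + _]addrC [d + _]addrC !shift.
Qed.

Lemma induces_inj R F1 F2 : induces R F1 -> induces R F2 -> F1 = F2.
Proof.
move=> RF1 RF2; apply: functional_extensionality_dep => g.
apply: funext => x; apply: funext => y; rewrite -[x]reprK -[y]reprK.
by apply/idP/idP => [/RF1/RF2|/RF2/RF1].
Qed.

(** Convexity of K_g is what gives antisymmetry on the quotient and lets signs pass between K and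
    the layers. *)
Lemma compatible_convex R a w g : group_order R -> compatible v R ->
  w \in val_gt v g -> R 0 a -> R a w -> a \in val_gt v g.
Proof. by move=> Rg Rc wg a0 /(Rc _ _ a0); apply: olt_le_trans. Qed.

Lemma order_family_group_order R : group_order R -> compatible v R ->
  forall g, group_order (order_family R g).
Proof.
move=> Rg Rc g; have gt0 : 0 \in val_gt v g by exact: rpred0.
have lift a b : R (\val a) (\val b) -> order_family R g (\pi a) (\pi b).
  by move=> ab; apply/order_family_induces; exists 0, 0; rewrite !addr0.
split; first split.
- by move=> x; rewrite -[x]reprK; apply/lift/group_order_refl.
- move=> x y; rewrite -[x]reprK -[y]reprK; set a := repr x; set b := repr y.
  case/andP => /order_family_induces [c [d [cg dg]]].
  rewrite group_order_subr // => ab.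
  move=> /order_family_induces [c' [d' [cg' dg']]].
  rewrite group_order_subr // => ba.
  apply/esym/layer_eq.
  (* The two inequalities place (b - a) + (d - c) between 0 and (d - c) + (d' - c'), which lies in
     K_g; by convexity b - a lies there too. *)
  have bacd : \val b + d - (\val a + c) = (\val b - \val a) + (d - c).
    by rewrite opprD addrACA.
  have abcd : \val a + d' - (\val b + c') = (d' - c') - (\val b - \val a).
    by rewrite opprD addrACA addrC opprB.
  rewrite -[_ - _](addrK (d - c)); apply: rpredB; last by rewrite rpredB.
  have cdg' : (d - c) + (d' - c') \in val_gt v g by apply: rpredD; apply: rpredB.
  rewrite bacd in ab; apply: (compatible_convex Rg Rc cdg' ab).
  by rewrite group_order_subr // [\val b - \val a + _]addrC opprD addrACA subrr add0r -abcd.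
- move=> y x z; rewrite -[x]reprK -[y]reprK -[z]reprK.
  move=> /order_family_induces [c [d [cg dg xy]]].
  move=> /order_family_induces [c' [d' [cg' dg' yz]]].
  apply/order_family_induces; exists (c + c'), (d' + d).
  split; rewrite ?rpredD //.
  have := group_order_addl Rg c' xy; have := group_order_addl Rg d yz.
  have -> : d + (\val (repr y) + c') = c' + (\val (repr y) + d).
    by rewrite [LHS]addrC [RHS]addrC addrAC.
  move=> yz' xy'; have := group_order_trans Rg xy' yz'.
  by rewrite [c' + _]addrC [d + _]addrC -!addrA.
- move=> x y; rewrite -[x]reprK -[y]reprK; apply/orP.
  by case/orP: (group_order_total Rg (\val (repr x)) (\val (repr y))) => /lift;
    [left | right].
- move=> x y z; rewrite -[x]reprK -[y]reprK -[z]reprK -!layerD.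
  move=> /order_family_induces [c [d [cg dg xy]]].
  apply/order_family_induces; exists c, d; split=> //.
  by rewrite /= ![_ + _ + c]addrAC ![_ + _ + d]addrAC; case: Rg => _; apply.
Qed.

Lemma order_family_lifting R : group_order R -> compatible v R ->
  is_lifting (order_family R) R.
Proof. by move=> Rg Rc; split=> //; apply: order_family_induces. Qed.

(** If the class of a is nonnegative but a is negative, then 0 <= - a <= d - c with d - c in K_g, so
    convexity puts a in K_g, against v a = g. *)
Lemma lifting_ge0 F R g (a : upper v g) : is_lifting F R ->
  v (\val a) = Some g -> R 0 (\val a) = F g 0 (\pi a).
Proof.
move=> [Rg Rc RF] va; have -> : (0 : layer v g) = \pi_(layer v g) 0.
  by apply: (addrI (\pi_(layer v g) 0)); rewrite -layerD !addr0.
apply/idP/idP => [a0|/RF [c [d [cg dg]]]].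
  by apply/RF; exists 0, 0; rewrite !addr0 !rpred0.
rewrite add0r group_order_subr // => cad; apply/negPn/negP.
rewrite -group_order_oppr_ge0 ?(neq0_val va) // => Na0.
have dcg : d - c \in val_gt v g by apply: rpredB.
have : - \val a \in val_gt v g.
  by apply: (compatible_convex Rg Rc dcg Na0); rewrite group_order_subr // opprK addrC addrA.
by rewrite rpredN unfold_in /val_gt va /olt /= og_lexx.
Qed.

(** [residue v] and [layer v 0] are convertible, so the condition on units is [lifting_ge0] at g =
    0. *)
Lemma lifting_cone F R :
  is_lifting F R -> field_order R -> positive_cone (F 0 : rel (residue v)) (R 0).
Proof.
move=> FR Rf; have [Rg _] := Rf; split; first exact: group_order_refl.
  by move=> a b; apply: field_order_mul_ge0.
move=> u vu; set x : upper v 0 := exist _ u (val_unit_ge vu).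
by rewrite -[u]/(\val x) (residue_of_val (x : valring v)) (lifting_ge0 FR).
Qed.

(** Nonzero residues lift to units, whose signs multiply in K. *)
Lemma lifting_residue_field_order F R : is_lifting F R -> field_order R ->
  group_order (F 0) -> field_order (F 0 : rel (residue v)).
Proof.
move=> FR Rf F0; split=> // x y.
have [_ RM] := Rf; have [_ _ FR0] := lifting_cone FR Rf.
have [a va <-] := residue_of_surj x; have [b vb <-] := residue_of_surj y.
have [->|/(residue_of_unit va) ua] := eqVneq (residue_of a) 0.
  by rewrite mul0r.
have [->|/(residue_of_unit vb) ub] := eqVneq (residue_of b) 0.
  by rewrite mulr0.
rewrite -residue_ofM // -!FR0 //; first exact: RM.
by rewrite valuationM ua ub /= addr0.
Qed.

Lemma is_lifting_inj F R1 R2 : field_order R1 -> field_order R2 ->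
  is_lifting F R1 -> is_lifting F R2 -> R1 = R2.
Proof.
move=> [R1g _] [R2g _] FR1 FR2; apply: funext => a; apply: funext => b.
rewrite group_order_subr // [RHS]group_order_subr //.
have [->|] := eqVneq (b - a) 0; first by rewrite !group_order_refl.
case/val_neq0 => g vg; have bag : b - a \in val_ge v g.
  by rewrite unfold_in /val_ge vg /= og_lexx.
set x : upper v g := exist _ (b - a) bag.
by rewrite -[b - a]/(\val x) (lifting_ge0 FR1) // (lifting_ge0 FR2).
Qed.

End Lifting.

End Valued.

(** * Construction of the bijection *)

Theorem theorem4p2 (K : fieldType) (G : ordered_group) (v : valuation K G) :
  exists f : rel (residue v) * (G -> int) -> (forall g : G, rel (layer v g)),
    set_bij (field_orders (residue v) `*` sign_homs G) (field_liftable v) f.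
Proof.
(* The hypothesis on [O] sits under the existential so that [choice] yields a base cone for every
   relation; [pred0] is the default for a relation that is not a field order. *)
have cone_exists (O : rel (residue v)) :
    exists P, field_order O -> positive_cone O P.
  have [/positive_cone_exists [P OP]|not_order] := pselect (field_order O).
    by exists P.
  by exists pred0.
have [base base_cone] := choice cone_exists.
pose cone (Oe : rel (residue v) * (G -> int)) := twist v (base Oe.1) Oe.2.
pose f Oe : forall g, rel (layer v g) := order_family (cone_order (cone Oe)).
have coneP O e : field_order O -> sign_homs G e -> positive_cone O (cone (O, e)).
  by move=> O_order eh; apply: twist_cone => //; apply: base_cone.
have cone_orderK P : cone_order P 0 = P :> pred K.
  by apply: funext => a; rewrite /cone_order subr0.
have f_lifting O e : field_order O -> sign_homs G e ->
    is_lifting (f (O, e)) (cone_order (cone (O, e))) /\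
    field_order (cone_order (cone (O, e))).
  move=> O_order eh; have Oe_cone := coneP _ _ O_order eh.
  have [Rg RM] := cone_order_field O_order Oe_cone.
  by split=> //; apply: order_family_lifting => //; apply: cone_order_compatible Oe_cone.
exists f; split.
- move=> [O e] [/= O_order eh]; have [fR Rf] := f_lifting _ _ O_order eh.
  split; last by exists (cone_order (cone (O, e))).
  by have [Rg Rc _] := fR; apply: order_family_group_order.
- move=> [O1 e1] [O2 e2] /set_mem [/= O1_order e1h] /set_mem [/= O2_order e2h] f12.
  have [fR1 R1f] := f_lifting _ _ O1_order e1h.
  have [fR2 R2f] := f_lifting _ _ O2_order e2h.
  rewrite -f12 in fR2; have R12 := is_lifting_inj R1f R2f fR1 fR2.
  have cone12 : cone (O1, e1) = cone (O2, e2).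
    by rewrite -[LHS]cone_orderK R12 cone_orderK.
  (* Each nonzero residue lifts to a unit, and both orders read its sign from the common cone. *)
  have O12 : O1 = O2.
    apply: funext => x; apply: funext => y.
    have [O1g _] := O1_order; have [O2g _] := O2_order.
    rewrite group_order_subr // [RHS]group_order_subr //.
    have [a va <-] := residue_of_surj (y - x).
    have [->|/(residue_of_unit va) ua] := eqVneq (residue_of v a) 0.
      by rewrite !group_order_refl.
    have [_ _ cone1] := coneP _ _ O1_order e1h.
    have [_ _ cone2] := coneP _ _ O2_order e2h.
    by rewrite -cone1 // -cone2 // cone12.
  rewrite -O12 in cone12 *; congr (_, _); exact: twist_inj cone12.
(* Surjectivity: the nonnegative elements of the lifting [R] form a cone over [F 0], hence a twist
   of the base cone of [F 0] by some [e], and [R] induces only one family. *)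
- move=> F [F_order [R [FR Rf]]].
  have F0_order := lifting_residue_field_order FR Rf (F_order 0).
  have R_cone := lifting_cone FR Rf.
  have [e eh Re] := twist_surj (base_cone _ F0_order) R_cone.
  exists (F 0 : rel (residue v), e) => //; have [Rg Rc RF] := FR.
  apply: (induces_inj _ RF); rewrite /f /cone /= -Re.
  suff -> : cone_order (R 0) = R by apply: order_family_induces.
  apply: funext => a; apply: funext => b.
  by rewrite [RHS]group_order_subr.
Qed.
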